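(* There is a constant $c>0$ such that for every $k\in\mathbb N$ and for arbitrarily large $n$ there exists a partial Boolean function $f:S\to\{0,1\}$ with $S\subseteq\{0,1\}^n$ such that $\mathrm{bs}(f)=k$ and $\mathrm{fbs}(f)\ge c\sqrt{n\cdot\mathrm{bs}(f)}$.
   Context: For $x\in S$, $x_i$ is its $i$-th bit. A set $B\subseteq[n]$ is a sensitive block of $x\in S$ if there is $y\in S$ with $f(y)\neq f(x)$ and $B=\{i:x_i\neq y_i\}$. $\mathrm{bs}(f,x)$ is the maximum number of pairwise disjoint sensitive blocks of $x$; $\mathrm{bs}(f)=\max_x\mathrm{bs}(f,x)$. $\mathrm{fbs}(f,x)$ is the maximum of $\sum_Bw(B)$ over weights $w(B)\in[0,1]$ on the sensitive blocks of $x$ with $\sum_{B\ni i}w(B)\le1$ for every $i\in[n]$; $\mathrm{fbs}(f)=\max_x\mathrm{fbs}(f,x)$. *)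

(* Defs.v *)
From HB Require Import structures.
From mathcomp Require Import all_boot all_order all_algebra.
From mathcomp Require Import classical_sets reals.

Set Implicit Arguments.
Unset Strict Implicit.
Unset Printing Implicit Defensive.

Import Order.TTheory GRing.Theory Num.Theory.
Local Open Scope ring_scope.

Definition cube (n : nat) : finType := {ffun 'I_n -> bool}.

(* A partial Boolean function with domain S is a function on the subtype S. *)
Definition partial_fun (n : nat) (S : {set cube n}) : Type :=
  {x : cube n | x \in S} -> bool.

Section BlockSensitivity.
Context (n : nat) (S : {set cube n}) (f : partial_fun S).
Implicit Types x y : {x : cube n | x \in S}.

Definition sensitive_block x (B : {set 'I_n}) : bool :=
  [exists y, (f y != f x) && (B == [set i | val x i != val y i])].

(* [trivIset P] is pairwise disjointness of the distinct members of [P];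
   the name is qualified because classical_sets shadows it. *)
Definition bs_at x : nat :=
  \max_(P : {set {set 'I_n}} |
        [forall B in P, sensitive_block x B] && finset.trivIset P) #|P|.

(* On an empty domain both [bs] and [fbs] are 0. *)
Definition bs : nat := \max_(x : {x : cube n | x \in S}) bs_at x.

Section Fractional.
Context (R : realType).

(* Only the values of [w] on the sensitive blocks of [x] matter. *)
Definition fractional_packing x (w : {set 'I_n} -> R) : Prop :=
  (forall B, sensitive_block x B -> 0 <= w B <= 1) /\
  (forall i : 'I_n, \sum_(B | sensitive_block x B && (i \in B)) w B <= 1).

(* The admissible weights on the sensitive blocks form a nonempty compact
   polytope, so this supremum is a maximum. *)
Definition fbs_at x : R :=
  sup [set t | exists2 w, fractional_packing x w
             & t = \sum_(B | sensitive_block x B) w B]%classic.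

(* The default value 0 is harmless because [fbs_at x] is nonnegative. *)
Definition fbs : R := \big[Num.max/0]_(x : {x : cube n | x \in S}) fbs_at x.

End Fractional.
End BlockSensitivity.

Arguments fbs {n S} f R.

(* Main.v *)
(** Given a family F of nonempty sets, let f be 0 at the zero input and 1 at the
    indicators of the members of F. The sensitive blocks of the zero input are
    the members of F, while every other input has a single sensitive block, so
    bs f is the matching number of F and fbs f is at least its fractional
    matching number. Take for F the k * m crosses
    {(i, a, b) : a = v or b = v} in k disjoint copies of an m x m grid: crosses
    of the same grid meet, so the matching number is k, and every point lies on
    at most two crosses, so weight 1/2 everywhere gives a fractional matching of
    size k m / 2 = sqrt (n k) / 2, where n = k m^2. *)
Require Import Defs.
From mathcomp Require Import all_boot all_order all_algebra.
From mathcomp Require Import reals.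

Import Order.TTheory GRing.Theory Num.Theory.
Local Open Scope ring_scope.

Section FamilyFunction.
Context {n : nat} (F : {set {set 'I_n}}).
Hypothesis F0 : set0 \notin F.

Definition indicator (A : {set 'I_n}) : cube n := [ffun i => i \in A].

Definition family_dom : {set cube n} := [set indicator A | A in set0 |: F].

Definition family_fun : partial_fun family_dom :=
  fun x => val x != indicator set0.

Lemma zero_in_dom : indicator set0 \in family_dom.
Proof. by apply: imset_f; rewrite !inE eqxx. Qed.

Definition zero_input : {x : cube n | x \in family_dom} :=
  exist _ (indicator set0) zero_in_dom.

Lemma indicatorK A : [set i | indicator A i] = A.
Proof. by apply/setP => i; rewrite !inE ffunE. Qed.

Lemma family_input x : family_fun x -> exists2 A, A \in F & val x = indicator A.
Proof.
rewrite /family_fun; case: x => x /= /imsetP[A + ->].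
by rewrite !inE => /orP[/eqP->|AF _]; [rewrite eqxx | exists A].
Qed.

Lemma sensitive_zero B : sensitive_block family_fun zero_input B = (B \in F).
Proof.
have f0 : family_fun zero_input = false by rewrite /family_fun /= eqxx.
apply/existsP/idP => [[y]|BF].
  rewrite f0 eqbF_neg negbK => /andP[/family_input[A AF ->] /eqP->].
  suff -> : [set i | val zero_input i != indicator A i] = A by [].
  by apply/setP => i; rewrite !inE !ffunE in_set0; case: (i \in A).
have BS : indicator B \in family_dom by apply: imset_f; rewrite !inE BF orbT.
exists (exist _ (indicator B) BS); rewrite f0 eqbF_neg negbK.
apply/andP; split.
  (* [F0] enters here: as [B] is nonempty, its indicator is not the zero input, so the function is 1
     there. *)
  apply/eqP => /= e; move: F0; rewrite -(indicatorK set0) -e indicatorK.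
  by rewrite BF.
by apply/eqP/setP => i; rewrite !inE !ffunE in_set0; case: (i \in B).
Qed.

(** Only the zero input carries the value 0, and it differs from [indicator A] exactly on [A]. *)
Lemma sensitive_nonzero A x B : val x = indicator A -> family_fun x ->
  sensitive_block family_fun x B -> B = A.
Proof.
move=> xA fx /existsP[y]; rewrite fx eqb_id negbK => /andP[/eqP y0 /eqP->].
by apply/setP => i; rewrite !inE xA y0 !ffunE in_set0; case: (i \in A).
Qed.

Lemma bs_family k :
    (exists P : {set {set 'I_n}},
       [/\ P \subset F, finset.trivIset P & #|P| = k]) ->
    (forall P : {set {set 'I_n}},
       P \subset F -> finset.trivIset P -> (#|P| <= k)%N) ->
  bs family_fun = k.
Proof.
move=> [P [PF tP cP]] maxk; apply/eqP; rewrite eqn_leq; apply/andP; split.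
  apply/bigmax_leqP => x _; apply/bigmax_leqP => Q /andP[/forall_inP sQ tQ].
  case fx: (family_fun x).
    have [A AF xA] := family_input x fx.
    (* The singleton of [A] is itself a matching in [F], so [maxk] bounds the nonzero inputs too,
       with no case split on [k]. *)
    have sQA : Q \subset [set A].
      by apply/subsetP => B /sQ /(sensitive_nonzero A x B xA fx) ->; rewrite inE.
    apply: leq_trans (subset_leq_card sQA) _; apply: maxk.
      by rewrite sub1set.
    by apply/trivIsetP => B C; rewrite !inE => /eqP-> /eqP->; rewrite eqxx.
  have x0 : x = zero_input by apply/val_inj/eqP; apply: negbFE fx.
  by apply: maxk tQ; apply/subsetP => B /sQ; rewrite x0 sensitive_zero.
rewrite -cP; apply: leq_trans (leq_bigmax zero_input).
rewrite /bs_at (bigop.bigmax_sup P) // tP andbT; apply/forall_inP => B BP.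
by rewrite sensitive_zero (subsetP PF).
Qed.

Lemma fbs_family (R : realType) (w : {set 'I_n} -> R) :
    (forall B, B \in F -> 0 <= w B <= 1) ->
    (forall i, \sum_(B in F | i \in B) w B <= 1) ->
  \sum_(B in F) w B <= fbs family_fun R.
Proof.
move=> w01 wi; apply: le_trans (le_bigmax_cond _ _ (isT : xpredT zero_input)).
rewrite /fbs_at; apply: ub_le_sup.
  (* The supremum is over a bounded set: weights are at most 1, so totals are at most the number of
     sensitive blocks. *)
  exists (\sum_(B | sensitive_block family_fun zero_input B) 1).
  by move=> _ [u [u01 _] ->]; apply: ler_sum => B /u01/andP[].
exists w; last by apply: eq_bigl => B; rewrite sensitive_zero.
split=> [B|i]; first by rewrite sensitive_zero => /w01.
by under eq_bigl => B do rewrite sensitive_zero; apply: wi.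
Qed.

End FamilyFunction.

Section Crosses.
Context (k m : nat).

Definition grid : finType := ('I_k * ('I_m * 'I_m))%type.

(** Coordinates of a [cube] are ordinals, hence the passage through [enum_val]. *)
Definition cross (p : 'I_k * 'I_m) : {set 'I_#|grid|} :=
  [set t | let: (i, (a, b)) := enum_val t : grid in
           (i == p.1) && ((a == p.2) || (b == p.2))].

Definition crosses : {set {set 'I_#|grid|}} := [set cross p | p : 'I_k * 'I_m].

Lemma mem_cross i a b p :
  (enum_rank ((i, (a, b)) : grid) \in cross p) =
  (i == p.1) && ((a == p.2) || (b == p.2)).
Proof. by rewrite inE enum_rankK. Qed.

(** A diagonal point lies on a single cross; this tells crosses apart and makes them nonempty. *)
Lemma cross_diag i v p :
  (enum_rank ((i, (v, v)) : grid) \in cross p) = ((i, v) == p).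
Proof. by rewrite mem_cross orbb; case: p. Qed.

Lemma cross_inj : injective cross.
Proof.
move=> [i v] q e; apply/eqP; rewrite -cross_diag -e.
by rewrite cross_diag eqxx.
Qed.

Lemma set0_notin_crosses : set0 \notin crosses.
Proof.
apply/imsetP => -[[i v] _ e].
by have := cross_diag i v (i, v); rewrite -e inE eqxx.
Qed.

(** The crosses of [v] and [u] in grid [i] share the point [(i, (v, u))]. Hence the grid index is
    injective on a matching, and there are [k] grids. *)
Lemma crosses_matching_le (P : {set {set 'I_#|grid|}}) :
  P \subset crosses -> finset.trivIset P -> (#|P| <= k)%N.
Proof.
move=> PF /trivIsetP tP.
have -> : P = cross @: (cross @^-1: P).
  apply/setP => B; apply/idP/imsetP => [BP|[p]]; last by rewrite inE => ? ->.
  by have /imsetP[p _ e] := subsetP PF B BP; exists p; rewrite // inE -e.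
rewrite (card_imset _ cross_inj) -(card_in_imset (f := fst)).
  by rewrite -[leqRHS]card_ord max_card.
move=> [i v] [j u]; rewrite !inE /= => vP uP ij; subst j.
apply/eqP/negPn/negP => ne.
have := tP _ _ vP uP; rewrite (inj_eq cross_inj) => /(_ ne)/pred0P.
move=> /(_ (enum_rank ((i, (v, u)) : grid))) /=.
by rewrite !mem_cross /= !eqxx orbT.
Qed.

(** Take one cross in each grid, always the one of index 0. *)
Lemma crosses_matching : (0 < m)%N -> exists P : {set {set 'I_#|grid|}},
  [/\ P \subset crosses, finset.trivIset P & #|P| = k].
Proof.
move=> m0; pose o := Ordinal m0; exists [set cross (i, o) | i : 'I_k]; split.
- by apply/subsetP => _ /imsetP[i _ ->]; apply: imset_f.
- apply/trivIsetP => _ _ /imsetP[i _ ->] /imsetP[j _ ->] ne.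
  apply/pred0P => t /=; apply/negP => /andP[]; rewrite !inE.
  case: (enum_val t) => l [a b] /= /andP[/eqP-> _] /andP[/eqP ij _].
  by rewrite ij eqxx in ne.
- by rewrite card_imset ?card_ord // => i j /cross_inj[].
Qed.

Lemma card_crosses : #|crosses| = (k * m)%N.
Proof. by rewrite card_imset ?card_prod ?card_ord //; apply: cross_inj. Qed.

Lemma crosses_degree t : (#|[set B in crosses | t \in B]| <= 2)%N.
Proof.
case e: (enum_val t : grid) => [i [a b]].
apply: (@leq_trans #|[set cross (i, a); cross (i, b)]|).
  apply/subset_leq_card/subsetP => B; rewrite !inE => /andP[/imsetP[[j v] _ ->]].
  by rewrite inE e /= => /andP[/eqP-> /orP[]/eqP->]; rewrite eqxx ?orbT.
by rewrite cards2; case: (_ != _).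
Qed.

Lemma fbs_crosses (R : realType) :
  (k * m)%:R / 2 <= fbs (family_fun crosses) R.
Proof.
rewrite mulr_natl -card_crosses -sumr_const.
apply: (fbs_family crosses set0_notin_crosses R (fun=> 2^-1)).
  by move=> B _; rewrite invr_ge0 ler0n invf_le1 ?ltr0n // ler1n.
move=> t; rewrite (eq_bigl (mem [set B in crosses | t \in B])); last first.
  by move=> B; rewrite !inE.
rewrite sumr_const -[leLHS]mulr_natl ler_pdivrMr ?ltr0n // mul1r ler_nat.
exact: crosses_degree.
Qed.

End Crosses.

Theorem theorem5 (R : realType) :
  exists c : R, 0 < c /\
    forall k N : nat, exists n : nat, (N <= n)%N /\
      exists (S : {set cube n}) (f : partial_fun S),
        bs f = k /\ c * Num.sqrt (n%:R * (bs f)%:R) <= fbs f R.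
Proof.
exists 2^-1; split; first by rewrite invr_gt0 ltr0n.
(* For [k = 0] there are no grid points, so [n] could not grow. The empty family on [N] coordinates
   serves instead, with lower bound 0. *)
move=> [|k] N.
  exists N; split=> //; exists (family_dom set0), (family_fun set0).
  have bs0 : bs (@family_fun N set0) = 0%N.
    apply: bs_family; first by rewrite inE.
      exists set0; rewrite cards0 sub0set; split=> //.
      by apply/trivIsetP => B; rewrite inE.
    by move=> P; rewrite subset0 => /eqP->; rewrite cards0.
  by rewrite bs0 mulr0 sqrtr0 mulr0 /fbs bigmax_ge_id.
(* This [m] is positive, as the matching requires, and makes the number of points at least [N]. *)
pose m := N.+1; exists #|grid k.+1 m|.
have cg : #|grid k.+1 m| = (k.+1 * (m * m))%N by rewrite !card_prod !card_ord.
split.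
  by rewrite cg; apply: (leq_trans (leqnSn N)); rewrite mulnA leq_pmull.
exists (family_dom (crosses k.+1 m)), (family_fun (crosses k.+1 m)).
have bsk : bs (family_fun (crosses k.+1 m)) = k.+1.
  apply: bs_family; first exact: set0_notin_crosses.
    exact: crosses_matching.
  exact: crosses_matching_le.
split=> //; rewrite bsk -natrM.
(* The product under the root is a perfect square, so the root is exactly the number of crosses. *)
have -> : (#|grid k.+1 m| * k.+1 = (k.+1 * m) ^ 2)%N.
  by rewrite cg mulnn mulnAC mulnn expnMn.
by rewrite natrX sqrtr_sqr normr_nat mulrC fbs_crosses.
Qed.
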